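(* Let $\Omega\subseteq\mathbb{R}^2$ be a domain and let $u\in\mathcal{C}^\infty(\Omega)$ with $|Du|<1$ on $\Omega$ be a solution to the $H_R=H_L$ surface equation $$\mathrm{div}\left(\left(\frac{1}{\sqrt{1-|Du|^2}}-\frac{1}{\sqrt{1+|Du|^2}}\right)Du\right)=0\quad\text{on }\Omega.$$ Then for every critical point $(x_0,y_0)\in\Omega$ of $u$ (i.e. every point with $Du(x_0,y_0)=0$) one has $H_R(x_0,y_0,u(x_0,y_0))=0$, where $H_R$ is the Euclidean mean curvature of the graph of $u$.
   Context: A domain is a nonempty connected open set. $D$, $|\cdot|$ and $\mathrm{div}$ denote the gradient, norm and divergence in the Euclidean plane $\mathbb{R}^2$. For $u\in\mathcal{C}^\infty(\Omega)$ let $\Sigma_u=\{(x,y,u(x,y)):(x,y)\in\Omega\}$ be its graph. Let $\mathbb{L}^3$ be $\mathbb{R}^3$ with the Lorentzian metric $dx^2+dy^2-dz^2$. The graph $\Sigma_u$ is spacelike (i.e. its metric induced from $\mathbb{L}^3$ is Riemannian) if and only if $|Du|<1$ on $\Omega$. The mean curvature functions of $\Sigma_u$ in $\mathbb{R}^3$ (with respect to the upward unit normal) and, when $|Du|<1$, in $\mathbb{L}^3$ (with respect to the future-directed unit normal) are, at the point $(x,y,u(x,y))$, $$H_R=\tfrac12\,\mathrm{div}\left(\frac{Du}{\sqrt{1+|Du|^2}}\right)(x,y),\qquad H_L=\tfrac12\,\mathrm{div}\left(\frac{Du}{\sqrt{1-|Du|^2}}\right)(x,y).$$ Thus the $H_R=H_L$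 surface equation says exactly that $H_R=H_L$ on $\Sigma_u$. *)

(* Defs.v *)
From mathcomp Require Import all_boot all_order all_algebra.
From mathcomp Require Import all_classical all_reals all_analysis.
Import Order.TTheory GRing.Theory Num.Theory.
Import numFieldNormedType.Exports.

Set Implicit Arguments.
Unset Strict Implicit.
Unset Printing Implicit Defensive.

Local Open Scope classical_set_scope.
Local Open Scope ring_scope.

(* The plane is 'rV[R]_2: its topology is the usual one, but the norm `|p| it
   carries in the library is the sup norm, whence [enorm]. *)

Definition domain (R : realType) (Omega : set 'rV[R]_2) : Prop :=
  [/\ Omega !=set0, connected Omega & open Omega].

Definition partial (R : realType) (i : 'I_2) (f : 'rV[R]_2 -> R) :
    'rV[R]_2 -> R :=
  fun p => 'D_(delta_mx 0 i) f p.

(* The derivative operator is total, so the existence of the partial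
   derivatives has to be required separately. *)
Fixpoint Ck (R : realType) (Omega : set 'rV[R]_2) (k : nat)
    (f : 'rV[R]_2 -> R) : Prop :=
  (forall p, Omega p -> {for p, continuous f}) /\
  match k with
  | 0%N => True
  | k'.+1 => forall i : 'I_2,
      (forall p, Omega p -> derivable f p (delta_mx 0 i)) /\
      Ck Omega k' (partial i f)
  end.

(* For open Omega; f is given on the whole plane, but only its values on Omega
   matter. *)
Definition smooth_on (R : realType) (Omega : set 'rV[R]_2)
    (f : 'rV[R]_2 -> R) : Prop :=
  forall k : nat, Ck Omega k f.

Definition grad (R : realType) (f : 'rV[R]_2 -> R) (p : 'rV[R]_2) :
    'rV[R]_2 :=
  \row_i partial i f p.

Definition enorm (R : realType) (v : 'rV[R]_2) : R :=
  Num.sqrt (\sum_(i < 2) v 0 i ^+ 2).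

Definition divergence (R : realType) (F : 'rV[R]_2 -> 'rV[R]_2)
    (p : 'rV[R]_2) : R :=
  \sum_(i < 2) partial i (fun q => F q 0 i) p.

(* Value at (p, u p) of the mean curvature, in Euclidean 3-space, of the graph
   of u, with respect to the upward unit normal. *)
Definition HR (R : realType) (u : 'rV[R]_2 -> R) (p : 'rV[R]_2) : R :=
  2^-1 * divergence
    (fun q => (Num.sqrt (1 + enorm (grad u q) ^+ 2))^-1 *: grad u q) p.

(* The H_R = H_L surface equation; 1 - |Du|^2 is positive only when
   |Du| < 1, which is not part of this definition. *)
Definition HR_eq_HL_equation (R : realType) (Omega : set 'rV[R]_2)
    (u : 'rV[R]_2 -> R) : Prop :=
  forall p, Omega p ->
    divergence
      (fun q => ((Num.sqrt (1 - enorm (grad u q) ^+ 2))^-1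
                 - (Num.sqrt (1 + enorm (grad u q) ^+ 2))^-1) *: grad u q) p
    = 0.

(* Main.v *)
Require Import Defs.
From mathcomp Require Import all_boot all_order all_algebra.
From mathcomp Require Import all_classical all_reals all_analysis.
From mathcomp Require Import ring lra.
Import Order.TTheory GRing.Theory Num.Theory.
Import numFieldNormedType.Exports.
Local Open Scope classical_set_scope.
Local Open Scope ring_scope.

(** At a critical point p0 the equation itself says nothing: the coefficient
    1 / sqrt (1 - |Du|^2) - 1 / sqrt (1 + |Du|^2) is |Du|^2 to leading order, so
    the equation degenerates there like that of the 4-Laplacian.  The
    information appears at second order.  Let A be the Hessian of u at p0.
    Along p0 + h x the gradient is h (x A) + o(h), so dividing the equation by
    h^2 and letting h tend to 0 gives, for every row vector x and y := x A,

      |y|^2 tr A + 2 <y A, y> = 0.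

    This forces tr A = 0.  If A is invertible then y is arbitrary, and summing
    over an orthonormal basis gives 4 tr A = 0.  If det A = 0 then
    A^2 = (tr A) A, so the left-hand side is 3 (tr A) |x A|^2, and either
    tr A = 0 or A = 0.  Since Du(p0) = 0, the Euclidean mean curvature at p0 is
    half the Laplacian tr A of u, hence zero.

    [mxtrace_eq0_of_image_form] is the algebraic step,
    [laplacian_critical_eq0] the passage to the limit, for any coefficient
    F (|Du|^2) with F(0) = 0 and F'(0) != 0; it rests on the product rule
    [divergence_radial] and on [is_derive_add_dir], which makes a function with
    continuous partial derivatives derivable in every direction. *)

(** * Directional derivatives *)

(** The two difference quotients are the same function of the increment. *)
Lemma is_derive_line (R : realType) (V : normedModType R) (f : V -> R)
    (p v : V) (t d : R) :
  is_derive t 1 (fun s : R => f (s *: v + p)) d <->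
  is_derive (t *: v + p) v f d.
Proof.
have E : (fun h : R =>
             h^-1 *: (((fun s : R => f (s *: v + p)) \o shift t) (h *: 1)
             - f (t *: v + p)))
       = (fun h : R => h^-1 *: ((f \o shift (t *: v + p)) (h *: v)
             - f (t *: v + p))).
  by apply/funext => h /=; rewrite [h *: 1]mulr1 scalerDl addrA.
by split=> -[dh <-]; split; move: dh; rewrite /derivable /derive E.
Qed.

Lemma is_derive_line0 (R : realType) (V : normedModType R) (f : V -> R)
    (p v : V) (d : R) :
  is_derive (0 : R) 1 (fun s : R => f (s *: v + p)) d <-> is_derive p v f d.
Proof. by have := is_derive_line R V f p v 0 d; rewrite scale0r add0r. Qed.

Lemma is_derive_comp1 (R : realType) (V : normedModType R) (F : R -> R)
    (f : V -> R) (p v : V) (dF df : R) :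
  is_derive (f p) 1 F dF -> is_derive p v f df ->
  is_derive p v (F \o f) (dF * df).
Proof.
move=> FdF /is_derive_line0 fdf; apply/is_derive_line0.
by apply: is_derive1_comp fdf; rewrite scale0r add0r.
Qed.

(** The mean value theorem on the segment from 0 to t, whatever the sign of t:
    increments along a line are then treated without orienting it. *)
Lemma MVT_from0 (R : realType) (f df : R -> R) (t : R) :
  (forall s : R, `|s| <= `|t| -> is_derive s 1 f (df s)) ->
  exists2 s, `|s| <= `|t| & f t - f 0 = df s * t.
Proof.
move=> fdf.
have fc (a b : R) : {in `[a, b]%R, forall s, `|s| <= `|t|} ->
    {within `[a, b], continuous f}.
  move=> ab; apply: derivable_within_continuous => s /ab /fdf fs.
  exact: ex_derive.
have [t0|t0] := leP 0 t.
  have ab : {in `[0, t]%R, forall s, `|s| <= `|t|}.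
    by move=> s; rewrite in_itv/= => /andP[? ?]; rewrite !ger0_norm.
  have [s s0t ->] := MVT_segment t0
    (fun s si => fdf s (ab s (subset_itv_oo_cc si))) (fc _ _ ab).
  by exists s; [exact: ab | rewrite subr0].
have ab : {in `[t, 0]%R, forall s, `|s| <= `|t|}.
  move=> s; rewrite in_itv/= => /andP[? ?].
  by rewrite !ler0_norm ?lerN2// ltW.
have [s s0t fE] := MVT_segment (ltW t0)
  (fun s si => fdf s (ab s (subset_itv_oo_cc si))) (fc _ _ ab).
by exists s; [exact: ab | rewrite -opprB fE sub0r mulrN opprK].
Qed.

(** Going from p to p + h (v + c w) by way of p + h v, the second leg is, by the
    mean value theorem, h c times a value of the w-derivative at a point that
    tends to p.  Only the w-derivative has to be continuous; starting from v = 0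
    and adding the coordinate directions one by one, this replaces total
    differentiability of functions with continuous partial derivatives. *)
Lemma is_derive_add_dir (R : realType) (V : normedModType R) (f : V -> R)
    (p v w : V) (a c : R) :
  is_derive p v f a ->
  (\forall q \near p, derivable f q w) ->
  {for p, continuous ('D_w f)} ->
  is_derive p (v + c *: w) f (a + c * 'D_w f p).
Proof.
move=> [fv fa] fw cw.
suff H : (fun h : R => h^-1 *: ((f \o shift p) (h *: (v + c *: w)) - f p))
    @ 0^' --> a + c * 'D_w f p.
  by split; [apply/cvg_ex; eexists; exact: H | exact: cvg_lim H].
have va : (fun h : R => h^-1 *: ((f \o shift p) (h *: v) - f p)) @ 0^' --> a.
  by rewrite -fa.
have E : (fun h : R => h^-1 *: ((f \o shift p) (h *: (v + c *: w)) - f p)) =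
  (fun h : R => h^-1 *: ((f \o shift p) (h *: v) - f p)
     + h^-1 *: (f ((h * c) *: w + (h *: v + p)) - f (h *: v + p))).
  apply/funext => h /=; rewrite -scalerDr; congr (_ *: _).
  by rewrite scalerDr scalerA addrAC (addrC _ (_ *: w)); ring.
rewrite E; apply: cvgD => //.
apply/cvgrPdist_le => e e0.
have : \forall q \near p, derivable f q w /\
    `|c * 'D_w f p - c * 'D_w f q| <= e.
  near=> q; split; first by near: q.
  near: q.
  have : c * 'D_w f q @[q --> p] --> c * 'D_w f p by apply: cvgMr; exact: cw.
  by move/cvgrPdist_le; apply.
move=> /nbhs_ballP[r /= r0 Br].
near=> h.
have h0 : h != 0 by near: h; exact: nbhs_dnbhs_neq.
have small s : `|s| <= `|h * c| -> ball p r (s *: w + (h *: v + p)).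
  move=> sh; rewrite -ball_normE/= addrA opprD addrCA subrr addr0 normrN.
  apply: (le_lt_trans (ler_normD _ _)); rewrite !normrZ.
  (* The summand 1 keeps the divisor nonzero when v = 0 and c w = 0. *)
  have : `|h| * (`|c| * `|w| + `|v| + 1) < r.
    rewrite -ltr_pdivlMr ?ltr_wpDl// ?addr_ge0 ?mulr_ge0//.
    near: h; apply: dnbhs0_lt.
    by rewrite divr_gt0// ltr_wpDl// ?addr_ge0 ?mulr_ge0.
  apply: le_lt_trans.
  rewrite mulrDr mulr1 mulrDr mulrA -normrM.
  by rewrite ler_wpDr// lerD2r ler_wpM2r.
have [|s /small ps] := @MVT_from0 R (fun s => f (s *: w + (h *: v + p)))
  (fun s => 'D_w f (s *: w + (h *: v + p))) (h * c).
  by move=> s /small /Br[dq _]; apply/is_derive_line; exact: derivableP.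
rewrite scale0r add0r => ->.
have -> (D : R) : h^-1 *: (D * (h * c)) = c * D.
  by rewrite mulrCA [_ *: _]mulKf// mulrC.
by have [] := Br _ ps.
Unshelve. all: by end_near. Qed.

(** * The trace of a planar matrix *)

(** On the image of A the form determines the trace: if A is onto, its
    symmetric part is the scalar - tr A / 2, and if A has rank at most 1, each
    y in the image satisfies y A = (tr A) y.  As A is an arbitrary matrix, this
    applies to a Hessian before its mixed derivatives are known to agree. *)
Lemma mxtrace_eq0_of_image_form (R : realFieldType) (A : 'M[R]_2) :
  (forall x : 'rV[R]_2, let y := x *m A in
    (\sum_j y 0 j ^+ 2) * \tr A
    + 2 * (\sum_i \sum_j y 0 i * y 0 j * A i j) = 0) ->
  \tr A = 0.
Proof.
move=> AE.
rewrite /mxtrace !big_ord_recl big_ord0 addr0.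
set i1 := lift ord0 ord0.
have {AE} AE (x0 x1 : R) :
    let y0 := x0 * A 0 0 + x1 * A i1 0 in
    let y1 := x0 * A 0 i1 + x1 * A i1 i1 in
    (y0 ^+ 2 + y1 ^+ 2) * (A 0 0 + A i1 i1)
    + 2 * (y0 ^+ 2 * A 0 0 + y0 * y1 * (A 0 i1 + A i1 0)
           + y1 ^+ 2 * A i1 i1) = 0.
  move=> y0 y1; rewrite -[RHS](AE (\row_j (if j == 0 then x0 else x1))).
  rewrite /mxtrace !(big_ord_recl, big_ord0) !mxE !(big_ord_recl, big_ord0).
  rewrite !mxE/=.
  rewrite !addr0 -/y0 -/y1; ring.
set a := A 0 0 in AE *; set b := A 0 _ in AE; set c := A _ 0 in AE.
set d := A _ _ in AE *.
clearbody a b c d; clear A.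
have [D0|D0] := eqVneq (a * d - b * c) 0; last first.
  (* The rows of the adjugate matrix are sent to multiples of the basis. *)
  have E0 : (a * d - b * c) ^+ 2 * (3 * a + d) = 0.
    by rewrite -[RHS](AE d (- b)); ring.
  have E1 : (a * d - b * c) ^+ 2 * (a + 3 * d) = 0.
    by rewrite -[RHS](AE (- c) a); ring.
  move/eqP: E0; rewrite mulf_eq0 expf_eq0/= (negPf D0)/= => /eqP E0.
  move/eqP: E1; rewrite mulf_eq0 expf_eq0/= (negPf D0)/= => /eqP E1.
  lra.
(* Now b c = a d; x runs over the two basis vectors. *)
have E0 : (a ^+ 2 + b ^+ 2) * (a + d) = 0.
  have := AE 1 0; rewrite /= !mul1r !mul0r !addr0 => E.
  by have := congr1 ( *%R a) D0; lra.
have E1 : (c ^+ 2 + d ^+ 2) * (a + d) = 0.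
  have := AE 0 1; rewrite /= !mul1r !mul0r !add0r => E.
  by have := congr1 ( *%R d) D0; lra.
have [//|t0] := eqVneq (a + d) 0; exfalso.
move/eqP: E0; rewrite mulf_eq0 (negPf t0) orbF paddr_eq0 ?sqr_ge0// !sqrf_eq0.
move/eqP: E1; rewrite mulf_eq0 (negPf t0) orbF paddr_eq0 ?sqr_ge0// !sqrf_eq0.
move=> /andP[_ /eqP d0] /andP[/eqP a0 _].
by rewrite a0 d0 addr0 eqxx in t0.
Qed.

(** * Divergence of a field F(|Du|^2) Du *)

Lemma sqr_enorm_grad (R : realType) (u : 'rV[R]_2 -> R) (q : 'rV[R]_2) :
  enorm (grad u q) ^+ 2 = \sum_j partial j u q ^+ 2.
Proof.
rewrite /enorm sqr_sqrtr; last by apply: sumr_ge0 => j _; exact: sqr_ge0.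
by apply: eq_bigr => j _; rewrite mxE.
Qed.

Lemma divergence_radial (R : realType) (u : 'rV[R]_2 -> R) (F : R -> R) (dF : R)
    (p : 'rV[R]_2) :
  (forall i j, derivable (partial j u) p (delta_mx 0 i)) ->
  is_derive (enorm (grad u p) ^+ 2) 1 F dF ->
  divergence (fun q => F (enorm (grad u q) ^+ 2) *: grad u q) p =
  F (enorm (grad u p) ^+ 2) * (\sum_i partial i (partial i u) p)
  + 2 * dF * (\sum_i \sum_j
      partial i u p * partial j u p * partial i (partial j u) p).
Proof.
move=> du dFw.
set w := fun q => enorm (grad u q) ^+ 2 in dFw *.
have dw i : is_derive p (delta_mx 0 i) w
    (2 * \sum_j partial j u p * partial i (partial j u) p).
  have -> : w = \sum_j (partial j u) ^+ 2.
    by apply/funext => q; rewrite /w sqr_enorm_grad fct_sumE.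
  rewrite mulr_sumr; apply: is_derive_sum => j.
  apply: is_derive_eq (is_deriveX _ (derivableP (du i j))) _.
  by rewrite expr1 /GRing.scale/= mulrA.
have dFw' i : is_derive p (delta_mx 0 i) (F \o w)
    (dF * (2 * \sum_j partial j u p * partial i (partial j u) p)).
  exact: is_derive_comp1.
rewrite /divergence mulr_sumr mulr_sumr -big_split/=.
apply: eq_bigr => i _; rewrite /partial.
have -> : (fun q => (F (w q) *: grad u q) 0 i) = (F \o w) * partial i u.
  by apply/funext => q; rewrite !mxE.
have [_ ->] := is_deriveM (dFw' i) (derivableP (du i i)).
rewrite /GRing.scale/=; congr (_ + _).
rewrite !mulr_sumr; apply: eq_bigr => j _; rewrite /partial; ring.
Qed.

(** * The equation at a critical point *)

Lemma cvg_sumr (R : realType) (T : Type) (F : set_system T) {FF : Filter F}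
    (n : nat) (f : 'I_n -> T -> R) (l : 'I_n -> R) :
  (forall i, f i x @[x --> F] --> l i) ->
  \sum_i f i x @[x --> F] --> \sum_i l i.
Proof.
elim: n f l => [|n IHn] f l fl.
  by under eq_fun do rewrite big_ord0; rewrite big_ord0; exact: cvg_cst.
under eq_fun do rewrite big_ord_recl; rewrite big_ord_recl.
by apply: cvgD => //; apply: IHn.
Qed.

(** The divergence at p0 + h x, divided by h^2, is the function Phi below: F(w)
    is G(w) w with G continuous and G(0) = F'(0), so both of its terms are
    quadratic in the gradient at p0 + h x, and the gradient divided by h
    converges to y = x A.  The limit of Phi is F'(0) times the form of
    [mxtrace_eq0_of_image_form]. *)
Lemma laplacian_critical_eq0 (R : realType) (Omega : set 'rV[R]_2)
    (u : 'rV[R]_2 -> R) (F dF : R -> R) (p0 : 'rV[R]_2) :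
  open Omega -> Ck Omega 2 u -> Omega p0 -> grad u p0 = 0 ->
  F 0 = 0 -> (\forall s \near (0 : R), is_derive (s : R) 1 F (dF s)) ->
  {for (0 : R), continuous dF} -> dF 0 != 0 ->
  (forall p, Omega p ->
    divergence (fun q => F (enorm (grad u q) ^+ 2) *: grad u q) p = 0) ->
  \sum_i partial i (partial i u) p0 = 0.
Proof.
move=> openO [_ u2] Op0 gu0 F0 FdF dFc dF0 divE.
have g0 j : partial j u p0 = 0.
  by move/matrixP/(_ 0 j): gu0; rewrite !mxE.
have gc j p : Omega p -> {for p, continuous (partial j u)}.
  by move=> Op; have [_ [+ _]] := u2 j; exact.
have gd j i p : Omega p -> derivable (partial j u) p (delta_mx 0 i).
  by move=> Op; have [_ [_ /(_ i)[+ _]]] := u2 j; exact.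
have hc i j p : Omega p -> {for p, continuous (partial i (partial j u))}.
  by move=> Op; have [_ [_ /(_ i)[_ [+ _]]]] := u2 j; exact.
have nO : \forall p \near p0, Omega p by exact: open_nbhs_nbhs.
pose A := \matrix_(i, j) partial i (partial j u) p0.
suff : \tr A = 0 by rewrite /mxtrace; under eq_bigr do rewrite mxE.
apply: mxtrace_eq0_of_image_form => x y.
have gx j : is_derive p0 x (partial j u) (y 0 j).
  have nd i : \forall q \near p0, derivable (partial j u) q (delta_mx 0 i).
    by near=> q; apply: gd; near: q.
  have -> : x = 0 + x 0 0 *: delta_mx 0 0
      + x 0 (lift ord0 ord0) *: delta_mx 0 (lift ord0 ord0).
    by rewrite [LHS]row_sum_delta !big_ord_recl big_ord0 addr0 add0r.
  apply: is_derive_eq.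
    apply: is_derive_add_dir (nd _) (hc _ _ _ Op0).
    exact: is_derive_add_dir (is_derive0 _ _) (nd _) (hc _ _ _ Op0).
  rewrite /y [RHS]mxE (big_ord_recl 1) (big_ord_recl 0) big_ord0 addr0 add0r.
  by rewrite [A _ _]mxE [X in _ = _ + _ * X]mxE.
pose T h : 'rV[R]_2 := h *: x + p0.
have T0 : T h @[h --> 0^'] --> p0.
  suff : {for 0, continuous T}.
    by move/continuous_withinNx; rewrite {2}/T scale0r add0r.
  apply: cvgD; last exact: cvg_cst.
  by apply: cvgZr_tmp; exact: cvg_id.
pose Y j h := h^-1 * partial j u (T h).
have Yc j : Y j h @[h --> 0^'] --> y 0 j.
  have [+ <-] := gx j; rewrite /derivable /derive g0.
  have -> // : (fun h : R =>
      h^-1 *: ((partial j u \o shift p0) (h *: x) - 0)) = Y j.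
  by apply/funext => h /=; rewrite subr0.
pose w h := enorm (grad u (T h)) ^+ 2.
have wE h : w h = \sum_j partial j u (T h) ^+ 2 by exact: sqr_enorm_grad.
have gTc j : partial j u (T h) @[h --> 0^'] --> 0.
  have := cvg_comp _ _ T0 (gc j _ Op0); rewrite g0; exact.
have w0 : w h @[h --> 0^'] --> 0.
  have : \sum_j partial j u (T h) ^+ 2 @[h --> 0^']
      --> \sum_(j < 2) (0 : R) * 0.
    by apply: cvg_sumr => j; apply: cvgM; exact: gTc.
  by rewrite big1 => [|j _]; [under eq_fun do rewrite -wE | rewrite mulr0].
have [G [FG Gc G0]] := (is_derive1_caratheodory _ _ _).1 (nbhs_singleton FdF).
have hTc i j : partial i (partial j u) (T h) @[h --> 0^'] --> A i j.
  rewrite mxE; exact: cvg_comp _ _ T0 (hc i j _ Op0).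
pose Phi h :=
  G (w h) * (\sum_j Y j h ^+ 2) * (\sum_i partial i (partial i u) (T h))
  + 2 * dF (w h)
    * (\sum_i \sum_j Y i h * Y j h * partial i (partial j u) (T h)).
have Phi0 : \forall h \near 0^', Phi h = 0.
  near=> h.
  have Th : Omega (T h) by near: h; exact: (T0 _ nO).
  have dw : is_derive (w h) 1 F (dF (w h)) by near: h; exact: (w0 _ FdF).
  have := divE _ Th.
  rewrite (divergence_radial _ _ _ _ _ (fun i j => gd j i _ Th) dw).
  rewrite -/(w h) -[F (w h)]subr0 -{1}F0 FG subr0 => E.
  rewrite -[RHS](mulr0 (h^-1 ^+ 2)) -[X in _ = _ * X]E mulrDr; congr (_ + _).
    have -> : \sum_j Y j h ^+ 2 = h^-1 ^+ 2 * w h.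
      by rewrite wE mulr_sumr; apply: eq_bigr => j _; rewrite exprMn.
    by rewrite (mulrCA (G _)) [RHS]mulrA.
  rewrite [RHS]mulrCA; congr (_ * _); rewrite mulr_sumr; apply: eq_bigr => i _.
  rewrite mulr_sumr; apply: eq_bigr => j _.
  by rewrite [RHS]mulrA /Y mulrACA.
have Phic : Phi h @[h --> 0^'] --> dF 0 * (\sum_j y 0 j ^+ 2) * \tr A
  + 2 * dF 0 * (\sum_i \sum_j y 0 i * y 0 j * A i j).
  apply: cvgD; apply: cvgM.
  - apply: cvgM; first by rewrite -G0; exact: cvg_comp _ _ w0 Gc.
    by apply: cvg_sumr => j; exact: cvgM.
  - by apply: cvg_sumr => i; exact: hTc.
  - by apply: cvgMr; exact: cvg_comp _ _ w0 dFc.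
  - apply: cvg_sumr => i; apply: cvg_sumr => j.
    by apply: cvgM => //; exact: cvgM.
have E : dF 0 * ((\sum_j y 0 j ^+ 2) * \tr A
    + 2 * (\sum_i \sum_j y 0 i * y 0 j * A i j)) = 0.
  rewrite mulrDr mulrA [dF 0 * (2 * _)]mulrA [dF 0 * 2]mulrC.
  apply: cvg_unique Phic _ => //; apply: cvg_near_cst.
  exact: Phi0.
by move/eqP: E; rewrite mulf_eq0 (negPf dF0) => /eqP.
Unshelve. all: by end_near. Qed.

Lemma is_derive_invsqrt (R : realType) (c s : R) : 0 < 1 + c * s ->
  is_derive s 1 (fun t : R => (Num.sqrt (1 + c * t))^-1)
    (- (c / 2) * (Num.sqrt (1 + c * s))^-1 ^+ 3).
Proof.
move=> cs0.
have r0 : Num.sqrt (1 + c * s) != 0 by rewrite sqrtr_eq0 -ltNge.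
have d1 : is_derive s 1 (fun t : R => 1 + c * t) c.
  have := is_deriveD (is_derive_cst (1 : R) s 1)
    (is_deriveZ c (is_derive_id s (1 : R))).
  by rewrite add0r /GRing.scale/= mulr1.
have d2 := @is_derive1_comp R Num.sqrt (fun t => 1 + c * t) s _ _
  (is_derive1_sqrt cs0) d1.
have d3 := @is_deriveV R (Num.sqrt \o (fun t => 1 + c * t)) s _ 1 r0 d2.
by apply: is_derive_eq d3 _; rewrite /GRing.scale/=; field; exact: r0.
Qed.

Theorem theorem1 (R : realType) (Omega : set 'rV[R]_2) (u : 'rV[R]_2 -> R)
    (Omega_domain : domain Omega)
    (u_smooth : smooth_on Omega u)
    (u_spacelike : forall p, Omega p -> enorm (grad u p) < 1)
    (u_sol : HR_eq_HL_equation Omega u) :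
  forall p0, Omega p0 -> grad u p0 = 0 -> HR u p0 = 0.
Proof.
move=> p0 Op0 gu0; have [_ _ openO] := Omega_domain.
(* The coefficient of the equation is f (-1) - f 1, that of HR is f 1. *)
pose f (c s : R) := (Num.sqrt (1 + c * s))^-1.
pose df (c s : R) := - (c / 2) * (Num.sqrt (1 + c * s))^-1 ^+ 3.
have sqrt1 (c : R) : Num.sqrt (1 + c * 0) = 1 by rewrite mulr0 addr0 sqrtr1.
have dfc (c : R) : {for (0 : R), continuous (df c)}.
  have rc : Num.sqrt (1 + c * s) @[s --> (0:R)] --> Num.sqrt (1 + c * 0).
    apply: (@cvg_comp _ _ _ (fun s => 1 + c * s)); last exact: sqrt_continuous.
    by apply: cvgD; [exact: cvg_cst | apply: cvgMr; exact: cvg_id].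
  apply: cvgMr; apply: (@cvg_comp _ _ _ _ (fun x : R => x ^+ 3)).
    by apply: cvgV rc; rewrite sqrt1 oner_neq0.
  exact: exprn_continuous.
have pos (c : R) : \forall s \near (0:R), 0 < 1 + c * s.
  have lc : 1 + c * s @[s --> (0:R)] --> 1 + c * 0.
    by apply: cvgD; [exact: cvg_cst | apply: cvgMr; exact: cvg_id].
  by apply: (cvgr_gt _ lc); rewrite mulr0 addr0.
have lap0 : \sum_i partial i (partial i u) p0 = 0.
  apply: (@laplacian_critical_eq0 R Omega u (f (-1) - f 1)
    (df (-1) - df 1) p0) => //.
  - by change (f (-1) 0 - f 1 0 = 0); rewrite /f !sqrt1 subrr.
  - near=> s.
    by apply: is_deriveB; apply: is_derive_invsqrt; near: s; exact: pos.
  - exact: continuousB.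
  - change (df (-1) 0 - df 1 0 != 0); rewrite /df !sqrt1 invr1 expr1n !mulr1.
    by have -> : - (-1 / 2) - - (1 / 2) = 1 :> R by field.
  - move=> p Op; rewrite -[RHS](u_sol p Op); congr (divergence _ p).
    apply/funext => q; congr (_ *: _).
    by rewrite -[LHS]/(f (-1) _ - f 1 _) /f mulN1r mul1r.
rewrite /HR.
have p0w : enorm (grad u p0) ^+ 2 = 0.
  by rewrite gu0 /enorm big1 ?sqrtr0 ?expr0n// => i _; rewrite mxE expr0n.
have d0 : is_derive (enorm (grad u p0) ^+ 2) 1
    (fun s : R => (Num.sqrt (1 + s))^-1) (df 1 0).
  rewrite p0w; under eq_fun do rewrite -[X in 1 + X]mul1r.
  by apply: is_derive_invsqrt; rewrite mulr0 addr0.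
have du i j : derivable (partial j u) p0 (delta_mx 0 i).
  by have [_ /(_ j)[_ [_ /(_ i)[+ _]]]] := u_smooth 2%N; exact.
rewrite (divergence_radial _ _ _ _ _ du d0) lap0 mulr0 add0r.
rewrite big1 ?mulr0// => i _; rewrite big1// => j _.
by move/matrixP/(_ 0 i): gu0; rewrite !mxE => ->; rewrite !mul0r.
Unshelve. all: by end_near. Qed.
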